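(* Let $n\ge 2$, $a\in(0,1)$, and $p(z)=(z-a)\prod_{k=1}^{n-1}(z-z_k)$ with $|z_k|\le 1$ for all $k$. Write $p'(z)=n\prod_{j=1}^{n-1}(z-\zeta_j)$ and $\rho_1=\min_{1\le j\le n-1}|a-\zeta_j|$. Suppose $\lambda$ is a real number with $$1-(1-|p(0)|)^{1/n}\le \lambda\le \sin(\pi/n),\qquad \lambda<a,$$ and suppose $\rho_1\ge 1$. Then there exists a critical point $\zeta_0$ of $p$ (i.e. $p'(\zeta_0)=0$) such that $$\operatorname{Re}\zeta_0\ \ge\ \frac12\Big(a-\frac{\lambda(\lambda+2)}{a}\Big).$$
   Context: The zeros $\zeta_1,\dots,\zeta_{n-1}$ of $p'$ (the critical points of $p$) are listed with multiplicity. *)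

(* Defs.v *)
From HB Require Import structures.
From mathcomp Require Import all_boot all_order all_algebra.
Set Implicit Arguments. Unset Strict Implicit. Unset Printing Implicit Defensive.
Import Order.TTheory GRing.Theory Num.Theory.
Local Open Scope ring_scope.

Definition pol (C : numClosedFieldType) (n : nat) (a : C) (z : 'I_n.-1 -> C)
  : {poly C} := ('X - a%:P) * \prod_(k < n.-1) ('X - (z k)%:P).

(* sin(pi/n): n.-root (-1) is the n-th root of -1 with minimal nonnegative
   argument, i.e. exp(i*pi/n); its imaginary part is sin(pi/n). *)
Definition sin_pi_div (C : numClosedFieldType) (n : nat) : C :=
  'Im (n.-root (-1 : C)).

(* Main.v *)
(* If w is within lam of a and p(w) = p(0), the Grace-Heawood theorem yields a
   critical point zeta with |zeta - w| <= |zeta|, hence |zeta - a| <= |zeta| + lam;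
   squaring and using |zeta| <= 1 (Gauss-Lucas) gives the bound on Re zeta.

   To find w, put f(x) = p(a + x) - p(0).  The critical points of f lie outside
   the open unit disc, so |f'(0)| >= n and |f(0)| = |p(0)| <= 1 - (1 - lam)^n.
   Taking n successive polar derivatives of f, at suitably chosen points of the
   disc |s| <= lam, produces the constant 0; by Grace's theorem f then has a zero
   in that disc.  This replaces the usual analytic covering argument and works
   over any algebraically closed field with a norm, without completeness. *)
Require Import Defs.
From HB Require Import structures.
From mathcomp Require Import all_boot all_order all_algebra.
From mathcomp Require Import ring.
Import Order.TTheory GRing.Theory Num.Theory.
Local Open Scope ring_scope.

(** * Polar derivatives *)

Section PolarDerivative.
Variable C : numClosedFieldType.
Implicit Types (f p : {poly C}) (S : seq C) (c r s u w x z rho : C).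

(** This is 1/d times the classical polar derivative d f + (s - X) f'. Here [d] is a formal degree:
    when deg f < d, the missing roots count as roots at infinity. *)
Definition polar (d : nat) s f : {poly C} :=
  f + d%:R^-1 *: ((s%:P - 'X) * f^`()).

(** The formal degree at each stage is the number of points still to be used, so an [f] of degree at
    most [size S] ends as a constant. *)
Fixpoint polar_seq S f : {poly C} :=
  if S is s :: S' then polar_seq S' (polar (size S) s f) else f.

Lemma horner_polar d s f z :
  (polar d s f).[z] = f.[z] + d%:R^-1 * ((s - z) * f^`().[z]).
Proof. by rewrite /polar !hornerE. Qed.

Lemma polar_is_linear d s k f p :
  polar d s (k *: f + p) = k *: polar d s f + polar d s p.
Proof.
rewrite /polar derivD derivZ mulrDr scalerDr -!mul_polyC; ring.
Qed.

Lemma polar_seq_is_linear S k f p :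
  polar_seq S (k *: f + p) = k *: polar_seq S f + polar_seq S p.
Proof.
by elim: S f p => //= s S IH f p; rewrite polar_is_linear IH.
Qed.

Lemma polar_seqZ S k f : polar_seq S (k *: f) = k *: polar_seq S f.
Proof.
have polar0 : polar_seq S 0 = 0.
  by have := polar_seq_is_linear S (-1) 0 0; rewrite scaler0 addr0 scaleN1r addNr.
by rewrite -[k *: f]addr0 polar_seq_is_linear polar0 addr0.
Qed.

Lemma size_polar d s f :
  (size f <= d.+2)%N -> (size (polar d.+1 s f) <= d.+1)%N.
Proof.
move=> szf; apply/leq_sizeP => i lei.
have f0 j : (d.+1 < j)%N -> f`_j = 0.
  by move=> ltj; apply: nth_default; apply: leq_trans szf _.
rewrite coefD coefZ mulrBl coefB coefCM coefXM !coef_deriv (f0 i.+1) //.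
case: i lei => [|i] // ledi /=; rewrite mul0rn mulr0 sub0r.
have [lti|gti|->] := ltngtP d i; last 2 first.
- by move: ledi; rewrite ltnS leqNgt gti.
- rewrite -[f`_i.+1 *+ i.+1]mulr_natr.
  by rewrite mulrN mulrCA mulVf ?mulr1 ?subrr // pnatr_eq0.
by rewrite f0 // mul0rn oppr0 mulr0 addr0.
Qed.

(** Carries information on the zeros of f' over to the derivative of the polar derivative. *)
Lemma deriv_polar d s f :
  (polar d.+2 s f)^`() = (d.+1%:R / d.+2%:R) *: polar d.+1 s f^`().
Proof.
have d2 : d.+2%:R != 0 :> C by rewrite pnatr_eq0.
have d1 : d.+1%:R != 0 :> C by rewrite pnatr_eq0.
rewrite /polar derivD derivZ derivM derivB derivC derivX [RHS]scalerDr scalerA.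
have -> : d.+1%:R / d.+2%:R * d.+1%:R^-1 = d.+2%:R^-1 :> C 
  by rewrite mulrAC divff // mul1r.
have -> : d.+1%:R / d.+2%:R = 1 - d.+2%:R^-1 :> C.
  by apply: (mulIf d2); rewrite mulrBl divfK // mul1r mulVf // -[in RHS]natr1 addrK.
rewrite -!mul_polyC polyCB; ring.
Qed.

Lemma polar_exp d s u :
  polar d.+1 s (('X - u%:P) ^+ d.+1) = (s - u) *: ('X - u%:P) ^+ d.
Proof.
have d1 : d.+1%:R != 0 :> C by rewrite pnatr_eq0.
rewrite /polar deriv_exp derivXsubC mul1r /= mulrnAr -scaler_nat scalerA.
rewrite mulVf // scale1r exprS -mulrDl -mul_polyC polyCB; congr (_ * _); ring.
Qed.

(** Powers of linear factors are where the iterated polar derivative is explicit; by linearity they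
    determine it. *)
Lemma polar_seq_exp S u :
  polar_seq S (('X - u%:P) ^+ size S) = (\prod_(s <- S) (s - u))%:P.
Proof.
elim: S => [|s S IH] /=; first by rewrite big_nil.
rewrite polar_exp big_cons polyCM mul_polyC -IH.
exact: polar_seqZ.
Qed.

(** * Logarithmic derivatives and the theorems of Laguerre and Grace *)

Lemma deriv_prod_XsubC S z : z \notin S ->
  (\prod_(r <- S) ('X - r%:P))^`().[z] =
  (\prod_(r <- S) ('X - r%:P)).[z] * \sum_(r <- S) (z - r)^-1.
Proof.
elim: S => [|r S IH]; first by rewrite !big_nil derivC horner0 mulr0.
rewrite inE negb_or => /andP[zr /IH {}IH].
rewrite !big_cons derivM derivXsubC mul1r hornerD !hornerM IH hornerXsubC.
by field; rewrite subr_eq0.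
Qed.

(** As a function of r this is the Möbius map (rho^2 - z^* r) / (z - r), which preserves the circle
    of radius rho. For |z| < rho it takes the outside into the disc, for |z| > rho the disc into
    itself; [laguerre] uses the first case, [gauss_lucas] the second. *)
Lemma inversion_disc z r rho : z != r -> 0 <= rho ->
  (`|(rho ^+ 2 - `|z| ^+ 2) / (z - r) + z^*| <= rho) =
  (0 <= (rho ^+ 2 - `|z| ^+ 2) * (`|r| ^+ 2 - rho ^+ 2)).
Proof.
move=> zr rho0; have zr0 : z - r != 0 by rewrite subr_eq0.
have rhoR : rho^* = rho by apply/CrealP; rewrite ger0_real.
have -> : (rho ^+ 2 - `|z| ^+ 2) / (z - r) + z^* = (rho ^+ 2 - z^* * r) / (z - r).
  by rewrite normCK; field.
rewrite normrM normfV ler_pdivrMr ?normr_gt0 //.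
rewrite -(@ler_pXn2r _ 2) ?nnegrE ?(mulr_ge0 rho0) // -subr_ge0.
suff -> : (rho * `|z - r|) ^+ 2 - `|rho ^+ 2 - z^* * r| ^+ 2 =
    (rho ^+ 2 - `|z| ^+ 2) * (`|r| ^+ 2 - rho ^+ 2) by [].
rewrite exprMn !normCK !rmorphB !rmorphM ?rmorphXn /= rhoR conjCK; ring.
Qed.

Lemma poly_roots_normal p : p != 0 ->
  exists2 S, p = lead_coef p *: \prod_(r <- S) ('X - r%:P)
    & (size S).+1 = size p /\ (forall r, (r \in S) = root p r).
Proof.
move=> p0; have [S pE] := closed_field_poly_normal p.
have l0 : lead_coef p != 0 by rewrite lead_coef_eq0.
exists S => //; split=> [|r].
  by rewrite [in RHS]pE size_scale // size_prod_XsubC.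
by rewrite [in RHS]pE rootZ // root_prod_XsubC.
Qed.

Lemma deriv_over_poly p z : p.[z] != 0 ->
  exists S, [/\ (size S).+1 = size p, forall r, (r \in S) = root p r
    & p^`().[z] = p.[z] * \sum_(r <- S) (z - r)^-1].
Proof.
move=> pz; have p0 : p != 0 by apply: contraNneq pz => ->; rewrite horner0.
have [S pE [szS rS]] := poly_roots_normal p p0; exists S; split=> //.
by rewrite pE derivZ !hornerZ deriv_prod_XsubC ?mulrA // rS.
Qed.

Lemma sumr_const_seq x S : \sum_(r <- S) x = x *+ size S.
Proof. by rewrite big_const_seq count_predT iter_addr_0. Qed.

(* Were z a zero, 1 / (z - s) would be the mean of the 1 / (z - r) over the d
   roots r (the missing ones being at infinity), all lying in a closed disc
   that does not contain 1 / (z - s). *)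
Lemma laguerre d c rho s f : 0 <= rho -> `|s - c| < rho ->
  (size f <= d.+2)%N ->
  (forall z, `|z - c| < rho -> f.[z] != 0) ->
  forall z, `|z - c| < rho -> (polar d.+1 s f).[z] != 0.
Proof.
move=> rho0 lts szf f0 z ltz; rewrite horner_polar.
have fz := f0 z ltz; have [S [szS rS ->]] := deriv_over_poly f z fz.
have d1 : d.+1%:R != 0 :> C by rewrite pnatr_eq0.
apply/eqP => E; have {E} E : d.+1%:R = (z - s) * \sum_(r <- S) (z - r)^-1.
  apply: (mulfI fz); apply/eqP; rewrite -subr_eq0; apply/eqP.
  rewrite -[RHS](mulr0 d.+1%:R) -[in RHS]E; field.
  by rewrite nat1r.
have zs : z != s by apply/eqP => zs; move/eqP: E; rewrite zs subrr mul0r (negbTE d1).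
have zs0 : z - s != 0 by rewrite subr_eq0.
pose D := rho ^+ 2 - `|z - c| ^+ 2.
have : ~~ (rho <= `|s - c|) by rewrite -real_ltNge ?ger0_real ?normr_ge0.
have D0 : 0 < D by rewrite subr_gt0 ltr_pXn2r ?nnegrE.
case/negP; rewrite -(@ler_pXn2r _ 2) ?nnegrE // -subr_ge0 -(pmulr_rge0 _ D0).
rewrite -inversion_disc ?(inj_eq (addIr _)) //.
have -> : z - c - (s - c) = z - s by ring.
have szSd : (size S <= d.+1)%N by rewrite -ltnS szS.
(* The [d.+1 - size S] roots at infinity contribute the image of infinity, [(z - c)^*], whose
   modulus is below [rho]. *)
have -> : D / (z - s) + (z - c)^* =
  (\sum_(r <- S) (D / (z - r) + (z - c)^*) + (z - c)^* *+ (d.+1 - size S)) / d.+1%:R.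
  rewrite big_split /= sumr_const_seq -mulr_sumr -addrA -mulrnDr subnKC //.
  have -> : \sum_(r <- S) (z - r)^-1 = d.+1%:R / (z - s) by rewrite E; field.
  rewrite -mulr_natr; by field; rewrite zs0 nat1r d1.
rewrite normrM normfV normr_nat ler_pdivrMr ?ltr0Sn //.
apply: le_trans (ler_normD _ _) _.
have -> : rho * d.+1%:R = rho *+ size S + rho *+ (d.+1 - size S).
  by rewrite -mulrnDr subnKC // mulr_natr.
apply: lerD; last by rewrite normrMn lerMn2r norm_conjC (ltW ltz) orbT.
apply: le_trans (ler_norm_sum _ _ _) _.
rewrite -sumr_const_seq big_seq [leRHS]big_seq; apply: ler_sum => r rSr.
have rrt : root f r by rewrite -rS.
have zr : z != r by apply: contraNneq fz => ->.
have -> : z - r = z - c - (r - c) by ring.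
rewrite inversion_disc ?(inj_eq (addIr _)) // pmulr_rge0 // subr_ge0.
rewrite ler_pXn2r ?nnegrE // real_leNgt ?ger0_real //.
by apply/negP => /f0; rewrite (eqP rrt) eqxx.
Qed.

(** By [laguerre], each polar derivative in turn keeps the disc free of zeros; the final constant is
    read off at the centre. *)
Lemma grace c rho S f : 0 < rho -> {in S, forall s, `|s - c| < rho} ->
  (size f <= (size S).+1)%N ->
  (forall z, `|z - c| < rho -> f.[z] != 0) -> (polar_seq S f).[c] != 0.
Proof.
move=> rho0; elim: S f => [|s S IH] f inS szf f0 /=.
  by apply: f0; rewrite subrr normr0.
have lts : `|s - c| < rho by apply: inS; rewrite inE eqxx.
apply: IH; first by move=> x xS; apply: inS; rewrite inE xS orbT.
  exact: size_polar.
exact: laguerre (ltW rho0) lts szf f0.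
Qed.

(** * The theorems of Gauss-Lucas and Grace-Heawood *)

(** As a polynomial in u, l((X - u)^n) has coefficients (-1)^j C(n,j) l(X^(n-j)). It vanishes
    everywhere, hence so do they, and the binomials are nonzero. *)
Lemma linear_exp_eq0 n (l : {poly C} -> C) :
  (forall k f p, l (k *: f + p) = k * l f + l p) ->
  (forall u, l (('X - u%:P) ^+ n) = 0) ->
  forall f, (size f <= n.+1)%N -> l f = 0.
Proof.
move=> lin lexp f szf.
have l0 : l 0 = 0.
  by have := lin (-1) 0 0; rewrite scaler0 addr0 mulN1r addNr.
have lZ k g : l (k *: g) = k * l g by rewrite -[k *: g]addr0 lin l0 addr0.
have lsum m (k : nat -> C) (g : nat -> {poly C}) :
    l (\sum_(i < m) k i *: g i) = \sum_(i < m) k i * l (g i).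
  elim: m => [|m IH]; first by rewrite !big_ord0.
  by rewrite !big_ord_recr /= addrC lin IH addrC.
suff lX i : (i <= n)%N -> l 'X^i = 0.
  rewrite -[f]coefK poly_def.
  rewrite (lsum (size f) (fun i => f`_i) (fun i => 'X^i)) big1 // => i _.
  by rewrite lX ?mulr0 // -ltnS (leq_trans (ltn_ord i)).
move=> lei.
pose g := \poly_(j < n.+1) ((-1) ^+ j * 'C(n, j)%:R * l 'X^(n - j)).
have g0 : g = 0.
  apply/eqP/negPn/negP => /closed_nonrootP[u /negP[]]; apply/eqP.
  rewrite -[RHS](lexp u) exprBn horner_poly.
  rewrite (eq_bigr (fun j : 'I_n.+1 =>
     ((-1) ^+ j * 'C(n, j)%:R * u ^+ j) *: 'X^(n - j))).
    rewrite (lsum n.+1 (fun j => (-1) ^+ j * 'C(n, j)%:R * u ^+ j) (fun j => 'X^(n-j))).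
    by apply: eq_bigr => j _; ring.
  move=> j _.
  rewrite -mul_polyC !polyCM !polyC_exp polyCN polyC1 rmorph_nat -mulr_natl; ring.
have := congr1 (fun h : {poly C} => h`_(n - i)) g0.
rewrite coef_poly coef0 ltnS leq_subr subKn // => /eqP.
rewrite !mulf_eq0 signr_eq0 /= pnatr_eq0 => /orP[|/eqP //].
by rewrite bin_sub // -leqn0 leqNgt bin_gt0 lei.
Qed.

(** Finiteness gives a uniform gap. The order of [C] is partial; a real [M] makes the values [F i]
    real, hence comparable. *)
Lemma finite_gap (I : eqType) (F : I -> C) (s : seq I) M : M \is Num.real ->
  {in s, forall i, M < F i} -> exists2 b, M < b & {in s, forall i, b <= F i}.
Proof.
move=> MR; elim: s => [_|i s IH H]; first by exists (M + 1); rewrite ?ltrDl ?ltr01.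
have [j js|b Mb bs] := IH; first by apply: H; rewrite inE js orbT.
have Mi : M < F i by apply: H; rewrite inE eqxx.
have bR : b \is Num.real by rewrite -(subrK M b) rpredD // gtr0_real // subr_gt0.
have iR : F i \is Num.real by rewrite -(subrK M (F i)) rpredD // gtr0_real // subr_gt0.
have [bi|ib] := real_leP bR iR.
  by exists b => // j; rewrite inE => /predU1P[->|/bs].
exists (F i) => // j; rewrite inE => /predU1P[->|/bs]//.
by apply: le_trans; apply: ltW.
Qed.

(** At a critical point z that is not a root, the 1 / (z - r) sum to 0. If |z| > rho, the inverted
    roots lie in the disc of radius rho and have mean z^*, a contradiction. *)
Lemma gauss_lucas p rho z : 0 <= rho -> (1 < size p)%N ->
  (forall r, root p r -> `|r| <= rho) -> root p^`() z -> `|z| <= rho.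
Proof.
move=> rho0 szp rootp rz.
have [/rootp //|/deriv_over_poly[S [szS rS E]]] := boolP (root p z).
have [pz|pz] := eqVneq p.[z] 0; first exact: rootp (introT eqP pz).
have {E} /eqP := E; rewrite (eqP rz) eq_sym mulf_eq0 (negbTE pz) /= => /eqP S0.
rewrite real_leNgt ?ger0_real //; apply/negP => ltz.
have S1 : (0 < size S)%N by rewrite -ltnS szS.
have : z^* *+ size S =
    \sum_(r <- S) ((rho ^+ 2 - `|z| ^+ 2) / (z - r) + z^*).
  by rewrite big_split /= -mulr_sumr S0 mulr0 add0r sumr_const_seq.
move/(congr1 Num.norm); rewrite normrMn norm_conjC => E.
have : `|z| *+ size S <= rho *+ size S.
  rewrite E; apply: le_trans (ler_norm_sum _ _ _) _.
  rewrite -sumr_const_seq big_seq [leRHS]big_seq; apply: ler_sum => r.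
  rewrite rS => rr; rewrite inversion_disc //; last by apply: contraNneq pz => ->.
  rewrite -mulrNN mulr_ge0 // opprB subr_ge0 ler_pXn2r ?nnegrE ?rootp //.
  exact: ltW.
by rewrite lerMn2r -(negbK (_ == _)) -lt0n S1 /= => /(lt_le_trans ltz); rewrite ltxx.
Qed.

Lemma prodr_subC u S :
  \prod_(r <- S) (u - r) = (-1) ^+ size S * \prod_(r <- S) (r - u).
Proof.
elim: S => [|r S IH]; first by rewrite !big_nil mulr1.
by rewrite !big_cons IH /= exprS; ring.
Qed.

(* Both sides of p(A) = p(B) are matched with the polar functional whose points
   b are the roots of (X - A)^n - (X - B)^n.  These are equidistant from A and
   B, so if every critical point were closer to A than to B, a large disc with
   centre c on the line AB would contain all the b but no critical point. *)
Lemma grace_heawood p A B : A != B -> (1 < size p)%N -> p.[A] = p.[B] ->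
  exists2 z, root p^`() z & `|z - B| <= `|z - A|.
Proof.
move=> AB; case E: (size p) => [|[|m]] // _ pAB.
have [dp0|dp0] := eqVneq p^`() 0.
  by exists B; rewrite ?dp0 ?root0 // subrr normr0.
have [T _ [_ rT]] := poly_roots_normal _ dp0.
have [/hasP[z]|/hasPn far] := boolP (has (fun z => `|z - B| <= `|z - A|) T).
  by rewrite rT; exists z.
pose N x := `|x - B| ^+ 2 - `|x - A| ^+ 2.
have [z zT|delta delta0 ledelta] := finite_gap C N T 0 (real0 _).
  rewrite subr_gt0 ltr_pXn2r ?nnegrE //.
  by rewrite real_ltNge ?ger0_real //; apply: far.
pose g : {poly C} := ('X - A%:P) ^+ m.+1 - ('X - B%:P) ^+ m.+1.
have gE : g = (B - A) *: \sum_(i < m.+1) ('X - A%:P) ^+ (m - i) * ('X - B%:P) ^+ i.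
  by rewrite /g subrXX -mul_polyC; congr (_ * _); rewrite polyCB; ring.
have size_term (i : 'I_m.+1) :
    size (('X - A%:P) ^+ (m - i) * ('X - B%:P) ^+ i) = m.+1.
  rewrite size_Mmonic ?monic_neq0 ?rpredX ?monicXsubC //.
  by rewrite !size_exp_XsubC addnS /= addSn subnK // -ltnS.
have szg : size g = m.+1.
  rewrite gE size_scale ?subr_eq0 1?eq_sym //; apply/anti_leq/andP; split.
    by apply: (leq_trans (size_sum _ _ _)); apply/bigmax_leqP => i _; rewrite size_term.
  (* The [m.+1] summands are monic of degree [m], so the coefficient of X^m in the sum is [m.+1],
     which is nonzero. *)
  rewrite ltnNge; apply/negP => /leq_sizeP/(_ m (leqnn m)).
  rewrite coef_sum (eq_bigr (fun=> 1)) => [|i _].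
    by rewrite sumr_const card_ord => /eqP; rewrite pnatr_eq0.
  have : ('X - A%:P) ^+ (m - i) * ('X - B%:P) ^+ i \is monic.
    by rewrite rpredM // rpredX // monicXsubC.
  by rewrite monicE lead_coefE size_term => /eqP.
have g0 : g != 0 by rewrite -size_poly_gt0 szg.
have [S gS [szS rS]] := poly_roots_normal _ g0.
have {szS} szS : size S = m by move: szS; rewrite szg => -[].
have : lead_coef g != 0 by rewrite lead_coef_eq0.
move: (lead_coef g) gS => L gS L0.
have NS b : b \in S -> N b = 0.
  rewrite rS rootE !hornerE subr_eq0 => /eqP/(congr1 Num.norm)/eqP.
  by rewrite !normrX eqrXn2 // => /eqP nbA; rewrite /N nbA subrr.
pose H := 1 + \sum_(b <- S) `|b - B| ^+ 2.
have HS b : b \in S -> `|b - B| ^+ 2 < H.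
  move=> bS; rewrite /H (big_rem b) //= addrCA ltrDl.
  by rewrite ltr_pwDl ?ltr01 // sumr_ge0 // => x _; rewrite exprn_ge0.
have H0 : 0 < H by rewrite ltr_pwDl ?ltr01 // sumr_ge0 // => x _; rewrite exprn_ge0.
(* With this [tau], [tau * N x] is at least [H] at every critical point, while [N] is 0 on [S]; by
   [normc] the radius [sqrtC (H + K)] separates the two sets. *)
pose tau := H / delta.
have tau0 : 0 < tau by rewrite divr_gt0.
have tauR : tau^* = tau by apply/CrealP; rewrite gtr0_real.
pose c := B + tau * (B - A).
pose K := tau * (1 + tau) * `|B - A| ^+ 2.
have K0 : 0 <= K.
  by rewrite /K mulr_ge0 ?exprn_ge0 // mulr_ge0 ?addr_ge0 ?ler01 // ltW.
have normc x : `|x - c| ^+ 2 = `|x - B| ^+ 2 + tau * N x + K.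
  by rewrite /N /K /c !normCK !rmorphB rmorphD rmorphM rmorphB /= tauR; ring.
have rho0 : 0 < sqrtC (H + K) by rewrite sqrtC_gt0 ltr_wpDr.
have ltrho x : (`|x - c| < sqrtC (H + K)) = (`|x - c| ^+ 2 < H + K).
  by rewrite -[in RHS](sqrtCK (H + K)) ltr_pXn2r ?nnegrE // ltW.
(* At (X - u)^(m+1) the first term is (m+1) L times the product of the b - u, and the second is its
   negative, since [g] has roots [S] and leading coefficient [L]. *)
pose l f := L * (polar_seq S f^`()).[c] + m.+1%:R * (f.[A] - f.[B]).
have l0 : l p = 0.
  apply: (linear_exp_eq0 m.+1 l) => [k f h|u|]; last by rewrite E.
    by rewrite /l derivD derivZ polar_seq_is_linear !(hornerD, hornerZ); ring.
  rewrite /l deriv_exp derivXsubC mul1r /= -scaler_nat.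
  rewrite polar_seqZ -szS polar_seq_exp szS hornerZ hornerC.
  have gu : (u - A) ^+ m.+1 - (u - B) ^+ m.+1 =
      L * ((-1) ^+ m * \prod_(b <- S) (b - u)).
    have := congr1 (fun h : {poly C} => h.[u]) gS.
    rewrite /g !(hornerXsubC, horner_exp, hornerZ, hornerD, hornerN, horner_prod).
    by under eq_bigr => b _ do rewrite hornerXsubC; rewrite prodr_subC szS.
  rewrite !(horner_exp, hornerXsubC).
  have swap x : (x - u) ^+ m.+1 = (-1) ^+ m.+1 * (u - x) ^+ m.+1.
    by rewrite -exprNn opprB.
  rewrite (swap A) (swap B) -mulrBr gu [(-1) ^+ m.+1]exprS.
  have sgn : (-1) ^+ m * (-1) ^+ m = 1 :> C by rewrite -expr2 sqrr_sign.
  set P := \prod_(b <- S) (b - u); set e := (-1) ^+ m in sgn *.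
  have -> : -1 * e * (L * (e * P)) = - (e * e) * (L * P) by ring.
  rewrite sgn; ring.
have : (polar_seq S p^`()).[c] != 0.
  apply: (grace c (sqrtC (H + K))) => //.
  - by move=> b bS; rewrite ltrho normc NS // mulr0 addr0 ltrD2r HS.
  - by rewrite szS -ltnS -E lt_size_deriv // -size_poly_gt0 E.
  move=> z; rewrite ltrho; apply: contraTneq => pz.
  have zT : z \in T by rewrite rT; apply/eqP.
  have HKR : H + K \is Num.real by rewrite gtr0_real // ltr_wpDr.
  rewrite -real_leNgt ?(rpredX _ (normr_real _)) // normc lerD2r.
  have -> : H = tau * delta by rewrite /tau divfK // gt_eqF.
  by rewrite ler_wpDl ?exprn_ge0 // ler_pM2l // ledelta.
by move/eqP: l0; rewrite /l pAB subrr mulr0 addr0 mulf_eq0 (negbTE L0) /= => ->.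
Qed.

(** * A zero in a small disc *)

(** The value at 0 is f(0) (1 + s t), where t averages the -1/r over the roots; all |r| >= 1, so |t|
    <= 1. *)
Lemma polar_lower_bound d s f : (size f <= d.+2)%N ->
  (forall z, `|z| < 1 -> f.[z] != 0) ->
  `|f.[0]| * (1 - `|s|) <= `|(polar d.+1 s f).[0]|.
Proof.
move=> szf f0; have f00 : f.[0] != 0 by apply: f0; rewrite normr0 ltr01.
have [S [szS rS E]] := deriv_over_poly f 0 f00.
have d1 : 0 < d.+1%:R :> C by rewrite ltr0Sn.
have -> : (polar d.+1 s f).[0] =
    f.[0] * (1 - - (s * (d.+1%:R^-1 * \sum_(r <- S) (0 - r)^-1))).
  by rewrite horner_polar E; ring.
rewrite normrM ler_wpM2l // (le_trans _ (lerB_dist _ _)) // normr1 lerD2l lerN2.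
rewrite normrN normrM ler_piMr // normrM normfV normr_nat mulrC ler_pdivrMr // mul1r.
have szSd : (size S <= d.+1)%N by rewrite -ltnS szS.
apply: le_trans (ler_norm_sum _ _ _) _.
apply: (@le_trans _ _ (1 *+ size S)); last by rewrite ler_nat.
rewrite -sumr_const_seq big_seq [leRHS]big_seq; apply: ler_sum => r.
rewrite rS => rr; rewrite sub0r normfV normrN.
have : 1 <= `|r| by rewrite real_leNgt // ?normr_real ?real1 //; apply/negP => /f0; rewrite (eqP rr) eqxx.
by move=> r1; rewrite invf_le1 // (lt_le_trans ltr01).
Qed.

(** Either -x/z is short enough and cancels x, or s of length [lam] is taken in its direction. *)
Lemma aligned_shift x z lam M : z != 0 -> 0 <= lam -> 0 <= M ->
  `|x| <= M + lam * `|z| ->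
  exists2 s, `|s| <= lam & `|x + s * z| <= M.
Proof.
move=> z0 lam0 M0 lex.
have nz : 0 < `|z| by rewrite normr_gt0.
have lz0 : 0 <= lam * `|z| by rewrite mulr_ge0.
have [le|lt] := real_leP (normr_real x) (ger0_real lz0).
  exists (- (x / z)); first by rewrite normrN normrM normfV ler_pdivrMr.
  by rewrite mulNr divfK // subrr normr0.
have nx : 0 < `|x| by apply: le_lt_trans lt.
have nx0 : `|x| != 0 by rewrite gt_eqF.
exists (- (lam * `|z| / `|x| * x / z)).
  rewrite normrN !normrM !normfV !normr_id (ger0_norm lam0).
  by rewrite divfK // mulfK // gt_eqF.
have -> : x + - (lam * `|z| / `|x| * x / z) * z = x / `|x| * (`|x| - lam * `|z|).
  by field; rewrite nx0 z0.
rewrite !normrM normfV normr_id divff // mul1r ger0_norm ?subr_ge0; last exact: ltW.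
by rewrite lerBlDr.
Qed.

(* Greedy choice: the i-th point s is aligned so as to decrease the absolute
   value at 0 by at least lam * (1 - lam)^i * |f'(0)| / deg f. *)
Lemma polar_seq_vanishing lam d f : 0 <= lam -> lam < 1 ->
  (size f <= d.+2)%N -> (forall z, `|z| < 1 -> f^`().[z] != 0) ->
  d.+1%:R * `|f.[0]| <= `|f^`().[0]| * (1 - (1 - lam) ^+ d.+1) ->
  exists S, [/\ size S = d.+1, {in S, forall s, `|s| <= lam}
    & (polar_seq S f).[0] = 0].
Proof.
move=> lam0 lam1; elim: d f => [|d IH] f szf f0 lef.
  have f00 : f^`().[0] != 0 by apply: f0; rewrite normr0 ltr01.
  have [||s les E] := aligned_shift f.[0] f^`().[0] lam 0 f00 lam0 => //.
    by move: lef; rewrite mul1r expr1 add0r mulrC; congr (_ <= _ * _); ring.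
  exists [:: s]; split=> // [x|]; first by rewrite inE => /eqP ->.
  rewrite /= horner_polar invr1 mul1r subr0; apply/eqP.
  by rewrite -normr_le0.
have f00 : f^`().[0] != 0 by apply: f0; rewrite normr0 ltr01.
have d2 : 0 < d.+2%:R :> C by rewrite ltr0Sn.
have lam'0 : 0 <= 1 - lam by rewrite subr_ge0 ltW.
have pow0 k : 0 <= 1 - (1 - lam) ^+ k.
  by rewrite subr_ge0 exprn_ile1 // gerBl.
(* [M] bounds what the induction hypothesis allows for the new value at 0, once [polar_lower_bound]
   costs the derivative a factor 1 - lam. *)
pose M := `|f^`().[0]| * ((1 - lam) * (1 - (1 - lam) ^+ d.+1)) / d.+2%:R.
have M0 : 0 <= M by rewrite /M divr_ge0 ?mulr_ge0 ?pow0.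
have [||||s les leM] := aligned_shift f.[0] (f^`().[0] / d.+2%:R) lam M => //.
- by rewrite mulf_neq0 // invr_eq0 gt_eqF.
- rewrite -(ler_pM2l d2) (le_trans lef) // normrM normfV normr_nat /M exprS.
  rewrite le_eqVlt; apply/orP; left; apply/eqP; field.
  by rewrite -natrD gt_eqF.
have szf' : (size f^`() <= d.+2)%N.
  have [->|fn0] := eqVneq f 0; first by rewrite deriv0 size_poly0.
  by rewrite -ltnS (leq_trans (lt_size_deriv fn0)).
have s1 : `|s| < 1 by apply: le_lt_trans lam1.
have d1 : 0 < d.+1%:R :> C by rewrite ltr0Sn.
have [|||S [szS Sl S0]] := IH (polar d.+2 s f).
- exact: size_polar.
- move=> z z1; rewrite deriv_polar hornerZ mulf_neq0 ?mulf_neq0 ?invr_eq0 ?(gt_eqF d1) ?(gt_eqF d2) //.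
  apply: (@laguerre d 0 1) => //; rewrite ?subr0 // => x; rewrite subr0; exact: f0.
- have := polar_lower_bound d s _ szf' f0.
  rewrite deriv_polar hornerZ !normrM normfV !normr_nat !horner_polar !subr0 => low.
  rewrite -[leRHS]mulrA -[leRHS]mulrA ler_pM2l //.
  have -> : d.+2%:R^-1 * (s * f^`().[0]) = s * (f^`().[0] / d.+2%:R) by ring.
  rewrite (le_trans leM) // /M mulrC ler_pM2l ?invr_gt0 //.
  rewrite mulrA ler_wpM2r // (le_trans _ low) // ler_wpM2l //.
  by rewrite lerD2l lerN2.
exists (s :: S); split=> [||]; rewrite /= ?szS //.
by move=> x; rewrite inE => /predU1P[->|/Sl].
Qed.

(** Without such a root, [finite_gap] gives a zero-free open disc of radius rho > lam; it contains
    the points of [S], so [grace] contradicts the vanishing. *)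
Lemma root_in_disc lam d f : 0 <= lam -> lam < 1 ->
  (size f <= d.+2)%N -> (forall z, `|z| < 1 -> f^`().[z] != 0) ->
  d.+1%:R * `|f.[0]| <= `|f^`().[0]| * (1 - (1 - lam) ^+ d.+1) ->
  exists2 z, root f z & `|z| <= lam.
Proof.
move=> lam0 lam1 szf f0 lef.
have [S [szS Sl S0]] := polar_seq_vanishing lam d f lam0 lam1 szf f0 lef.
have fn0 : f != 0.
  have := f0 0; rewrite normr0 ltr01 => /(_ isT).
  by apply: contraNneq => ->; rewrite deriv0 horner0.
have [T _ [_ rT]] := poly_roots_normal _ fn0.
have [/hasP[z]|/hasPn far] := boolP (has (fun z => `|z| <= lam) T).
  by rewrite rT; exists z.
have [z zT|rho ltrho lerho] := finite_gap C Num.norm T lam (ger0_real lam0).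
  by rewrite real_ltNge ?ger0_real //; apply: far.
have rho0 : 0 < rho by apply: le_lt_trans ltrho.
suff : (polar_seq S f).[0] != 0 by rewrite S0 eqxx.
apply: (grace 0 rho) => //.
- by move=> s /Sl; rewrite subr0 => /le_lt_trans; apply.
- by rewrite szS.
move=> z; rewrite subr0; apply: contraTneq => fz.
have /lerho : z \in T by rewrite rT; apply/eqP.
by rewrite real_leNgt // gtr0_real.
Qed.

End PolarDerivative.

(** * The bound on the real part *)

Theorem theorem1 (C : numClosedFieldType) (n : nat) (a : C)
  (z : 'I_n.-1 -> C) (zeta : 'I_n.-1 -> C) (lam : C) :
  (2 <= n)%N ->
  a \is Num.real -> 0 < a -> a < 1 ->
  (forall k, `|z k| <= 1) ->
  (pol a z)^`() = n%:R *: \prod_(j < n.-1) ('X - (zeta j)%:P) ->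
  lam \is Num.real ->
  1 - n.-root (1 - `|(pol a z).[0]|) <= lam ->
  lam <= sin_pi_div C n ->
  lam < a ->
  (forall j, 1 <= `|a - zeta j|) ->
  exists zeta0 : C, root (pol a z)^`() zeta0 /\
    (a - lam * (lam + 2) / a) / 2 <= 'Re zeta0.
Proof.
case: n z zeta => [|[|m]] //= z zeta _ aR a0 a1 z1 dp lamR lelam _ ltlam far.
set p := @pol C m.+2 a z in dp lelam *.
have lam1 : lam < 1 by apply: lt_trans a1.
have szp : size p = m.+3.
  rewrite /p /pol size_monicM ?monicXsubC //; last first.
    by rewrite monic_neq0 // monic_prod_XsubC.
  by rewrite size_XsubC -big_enum size_prod_XsubC -cardE card_ord.
have rootp r : root p r -> `|r| <= 1.
  rewrite /p /pol rootM root_XsubC => /orP[/eqP ->|].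
    by rewrite gtr0_norm // ltW.
  rewrite rootE horner_prod prodf_seq_eq0 => /hasP[k _].
  by rewrite hornerXsubC subr_eq0 => /eqP ->.
have pa : p.[a] = 0 by rewrite /p /pol hornerM hornerXsubC subrr mul0r.
have p0 : `|p.[0]| <= 1.
  rewrite /p /pol hornerM hornerXsubC sub0r normrM normrN (gtr0_norm a0).
  rewrite mulr_ile1 ?(ltW a0) ?(ltW a1) // horner_prod normr_prod prodr_ile1 // => k _.
  by rewrite hornerXsubC sub0r normrN normr_ge0 z1.
have lam0 : 0 <= lam.
  by apply: le_trans lelam; rewrite subr_ge0 rootC_le1 ?subr_ge0 // gerBl.
have lep0 : `|p.[0]| <= 1 - (1 - lam) ^+ m.+2.
  rewrite lerBrDr addrC -lerBrDr -[leRHS](@rootCK _ m.+2) //.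
  rewrite ler_pXn2r ?nnegrE ?rootC_ge0 ?subr_ge0 ?(ltW lam1) //.
  by rewrite lerBlDr addrC -lerBlDr.
have dpE x : p^`().[x] = m.+2%:R * \prod_(j < m.+1) (x - zeta j).
  by rewrite dp hornerZ horner_prod; under eq_bigr => j _ do rewrite hornerXsubC.
pose f := p \Po ('X + a%:P) - (p.[0])%:P.
have fE x : f.[x] = p.[x + a] - p.[0] by rewrite /f !hornerE horner_comp !hornerE.
have dfE x : f^`().[x] = p^`().[x + a].
  rewrite /f derivB derivC subr0 deriv_comp derivD derivX derivC addr0 mulr1.
  by rewrite horner_comp !hornerE.
have [|x x1||w fw lew] := root_in_disc C lam m.+1 f lam0 lam1.
- rewrite /f (leq_trans (size_polyD _ _)) // geq_max size_polyN.
  rewrite (leq_trans (size_polyC_leq1 _)) // andbT.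
  by rewrite size_comp_poly2 ?szp // size_XaddC.
- rewrite dfE dpE mulf_neq0 ?pnatr_eq0 // prodf_seq_neq0; apply/allP => j _ /=.
  apply: contraTneq x1 => xj; rewrite -real_leNgt ?normr_real ?real1 //.
  suff -> : x = - (a - zeta j) by rewrite normrN.
  by rewrite opprB -[zeta j](subKr (x + a)) xj subr0 addrK.
(* The factor n cancels; what remains of |f'(0)| is the product of the |a - zeta j|, which is at
   least 1. *)
- rewrite dfE fE !add0r pa sub0r normrN dpE normrM normr_nat -mulrA ler_wpM2l //.
  rewrite (le_trans lep0) // ler_peMl ?subr_ge0 ?exprn_ile1 ?subr_ge0 ?(ltW lam1) ?gerBl //.
  rewrite normr_prod; apply: (big_ind (fun x => 1 <= x)) => // x y.
  exact: mulr_ege1.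
(* Grace-Heawood needs distinct points 0 and w + a; they are distinct because |w| <= lam < a. *)
have wa0 : w + a != 0.
  apply: contraTneq ltlam => /eqP; rewrite addr_eq0 => /eqP wa.
  by rewrite -real_leNgt ?(gtr0_real a0) // -(gtr0_norm a0) -normrN -wa.
have [||| zeta0 rz lez] := grace_heawood C p 0 (w + a).
- by rewrite eq_sym.
- by rewrite szp.
- by apply/eqP; rewrite eq_sym -subr_eq0 -fE.
exists zeta0; split=> //.
have z01 : `|zeta0| <= 1 by apply: (@gauss_lucas C p) rz; rewrite ?szp.
have lea : `|zeta0 - a| <= `|zeta0| + lam.
  have -> : zeta0 - a = zeta0 - (w + a) + w by ring.
  by apply: le_trans (ler_normD _ _) _; rewrite lerD // -[in leRHS](subr0 zeta0).
have : `|zeta0 - a| ^+ 2 <= `|zeta0| ^+ 2 + lam * (lam + 2).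
  apply: (@le_trans _ _ ((`|zeta0| + lam) ^+ 2)).
    by rewrite ler_pXn2r ?nnegrE ?addr_ge0.
  rewrite -subr_ge0.
  have -> : `|zeta0| ^+ 2 + lam * (lam + 2) - (`|zeta0| + lam) ^+ 2 =
    2 * lam * (1 - `|zeta0|) by ring.
  by rewrite !mulr_ge0 // subr_ge0.
have aC : a^* = a by apply/CrealP.
have -> : `|zeta0 - a| ^+ 2 = `|zeta0| ^+ 2 + (a ^+ 2 - 2 * a * 'Re zeta0).
  have -> : 2 * a * 'Re zeta0 = a * (zeta0 + zeta0^*).
    by rewrite ReE; field.
  by rewrite !normCK rmorphB /= aC; ring.
rewrite lerD2l => le2.
rewrite -subr_ge0.
have -> : 'Re zeta0 - (a - lam * (lam + 2) / a) / 2 =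
    (lam * (lam + 2) - (a ^+ 2 - 2 * a * 'Re zeta0)) / (2 * a).
  by field; rewrite gt_eqF.
by rewrite divr_ge0 ?subr_ge0 // mulr_ge0 // ltW.
Qed.
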